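(* Let $\phi:(0,\infty)\to(0,\infty)$ be a monotone increasing function such that $\lim_{t\to\infty}\phi(t)=+\infty$. Then there exists a convex function $g:(0,\infty)\to(0,\infty)$ such that \[ \lim_{t\to\infty} g(t)=0,\qquad \int_0^\infty\sqrt{-g'(t)}\,\mathrm{d}t<+\infty,\qquad \limsup_{t\to\infty}\big(t\cdot\phi(t)\cdot g(t)\big)=+\infty. \]
   Context: $g'$ denotes the derivative of the convex function $g$, which exists for almost every $t$; since $g$ is convex with limit $0$ at infinity, $g$ is decreasing and $-g'\ge 0$. *)

(* Defs.v *)
From HB Require Import structures.
From mathcomp Require Export all_boot all_order all_algebra.
From mathcomp Require Export all_classical all_reals all_analysis.

(* Main.v *)
Require Import Defs.
From mathcomp Require Import measurable_realfun ring lra.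
Set Implicit Arguments.
Unset Strict Implicit.
Unset Printing Implicit Defensive.
Import Order.TTheory GRing.Theory Num.Theory.
Import numFieldNormedType.Exports.
Local Open Scope classical_set_scope.
Local Open Scope ring_scope.

(** Take [g] to be the supremum of the tents [t |-> c_n * max(0, T_n - t)] with
    [c_n = (2^-n / T_n)^2].  Each tent is at most [1/t], so [g] is well defined,
    convex, and tends to 0.  Only the tents with [T_n > t] are decreasing at [t],
    so [- g'(t)] is at most any common bound of their slopes [c_n], whence
    [sqrt (- g'(t)) <= \sum_n sqrt c_n * 1_(t < T_n)], whose integral is at most
    [\sum_n sqrt c_n * T_n = \sum_n 2^-n].  At [t = T_n / 2] the [n]-th tent
    alone gives [t * phi t * g t >= phi (T_n / 2) / (4 * 4^n)], which is at least
    [n] once [T_n] is large enough. *)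

(** The integral of a nonnegative function is a supremum over the simple functions below it, so it
    is monotone without any measurability of [f], here [sqrt (- g')]. *)
Lemma ge0_le_integral_nomeas d (T : measurableType d) (R : realType)
    (mu : {measure set T -> \bar R}) (D : set T) (f g : T -> \bar R) :
  (forall x, D x -> 0 <= f x)%E -> (forall x, D x -> f x <= g x)%E ->
  (\int[mu]_(x in D) f x <= \int[mu]_(x in D) g x)%E.
Proof.
move=> f0 fg; have g0 x : D x -> (0 <= g x)%E.
  by move=> Dx; rewrite (le_trans (f0 x Dx)) ?fg.
rewrite !ge0_integralE//; apply: ge_ereal_sup => _ [h /= hf <-].
apply: ereal_sup_ubound; exists h => //= x.
by apply: le_trans (hf x) _; exact: lee_restrict.
Qed.

(* No differentiability is assumed: where the limit defining [derive1 f t] does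
   not exist, its value is [point], that is 0. *)
Lemma opp_derive1_le (R : realType) (f : R -> R) (t K : R) : 0 <= K ->
  (forall s, t < s -> f t - f s <= K * (s - t)) -> - derive1 f t <= K.
Proof.
move=> K0 fK; rewrite lerNl /derive1.
set F := (X in lim X).
have [cF|/dvgP ->] := pselect (cvg F); last by rewrite oppr_le0.
(* An existing limit agrees with the right-hand one, so only the increments [h > 0] covered by [fK]
   matter. *)
rewrite /F cvg_at_rightE//; apply: limr_ge.
  apply/cvg_ex; exists (lim F); exact: cvg_dnbhs_at_right.
near=> h; have h0 : 0 < h by near: h; exact: nbhs_right_gt.
have /fK : t < h + t by rewrite ltrDr.
rewrite addrK => le_fh; rewrite /GRing.scale/= mulrC ler_pdivlMr//; lra.
Unshelve. all: by end_near. Qed.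

Section TentEnvelope.
Context {R : realType}.
(* [a n] is the square root of the slope of the [n]-th tent, [T n] its foot. *)
Variables a T : nat -> R.
Hypothesis a_gt0 : forall n, 0 < a n.
Hypothesis T_gt0 : forall n, 0 < T n.
Hypothesis aT_le : forall n, a n * T n <= 2^-1 ^+ n.

Definition tent n t := a n ^+ 2 * Num.max 0 (T n - t).

Definition tent_sup t := sup (range (tent^~ t)).

Lemma tent_ge0 n t : 0 <= tent n t.
Proof. by rewrite mulr_ge0 ?sqr_ge0// le_max lexx. Qed.

(** For [t < T n], both [t] and [T n - t] are at most [T n], so
    [t * tent n t <= (a n * T n) ^+ 2 <= 1]. *)
Lemma tent_le_inv n t : 0 < t -> tent n t <= t^-1.
Proof.
move=> t0; rewrite /tent; have [Tt|tT] := leP (T n - t) 0.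
  by rewrite mulr0 invr_ge0 ltW.
have aT1 : a n * T n <= 1.
  by rewrite (le_trans (aT_le n))// exprn_ile1// invf_le1 ?ler1n.
have aT0 : 0 < a n * T n by rewrite mulr_gt0.
rewrite -[leRHS]mul1r ler_pdivlMr//.
have ? := a_gt0 n; have ? := T_gt0 n; have ? : t <= T n by lra.
apply: (@le_trans _ _ ((a n * T n) ^+ 2)); last by rewrite exprn_ile1// ltW.
rewrite exprMn -mulrA ler_wpM2l ?sqr_ge0// expr2 ler_pM//; lra.
Qed.

Lemma has_ubound_tent t : 0 < t -> has_ubound (range (tent^~ t)).
Proof. by move=> t0; exists t^-1 => _ [n _ <-]; exact: tent_le_inv. Qed.

Lemma tent_le_sup n t : 0 < t -> tent n t <= tent_sup t.
Proof. by move=> t0; apply: ub_le_sup; [exact: has_ubound_tent|exists n]. Qed.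

Lemma tent_sup_le t M : (forall n, tent n t <= M) -> tent_sup t <= M.
Proof.
move=> tM; apply: ge_sup; first by exists (tent 0 t), 0%N.
by move=> _ [n _ <-].
Qed.

Lemma tent_sup_gt0 t : (exists n, t < T n) -> 0 < t -> 0 < tent_sup t.
Proof.
move=> [n tT] t0; apply: lt_le_trans (tent_le_sup n t0).
by rewrite mulr_gt0 ?exprn_gt0// lt_max subr_gt0 tT orbT.
Qed.

Lemma tent_sup_cvg0 : tent_sup t @[t --> +oo] --> 0.
Proof.
apply: (@squeeze_cvgr _ _ _ _ (cst 0) (fun t : R => t^-1)).
- near=> t; have t0 : 0 < t by near: t; exact: nbhs_pinfty_gt.
  rewrite /cst (le_trans (tent_ge0 0 t)) ?tent_le_sup//=.
  by apply: tent_sup_le => n; exact: tent_le_inv.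
- exact: cvg_cst.
- apply/cvgrPdist_le => e e0; near=> t.
  have te : e^-1 <= t by near: t; apply: nbhs_pinfty_ge; rewrite num_real.
  have t0 : 0 < t by rewrite (lt_le_trans _ te)// invr_gt0.
  by rewrite sub0r normrN gtr0_norm ?invr_gt0// invf_ple.
Unshelve. all: by end_near. Qed.

Lemma convex_tent_sup :
  convex_function (`]0, +oo[%classic : set R) tent_sup.
Proof.
move=> p x y /set_mem/= + /set_mem/=; rewrite !in_itv/= !andbT => x0 y0.
pose z : R := p%:num * x + (1 - p%:num) * y.
rewrite convRE -[X in tent_sup X]/z /unstable.onem; apply: tent_sup_le => n.
have p0 : 0 <= p%:num by [].
have q0 : 0 <= 1 - p%:num by rewrite subr_ge0.
apply: (@le_trans _ _ (p%:num * tent n x + (1 - p%:num) * tent n y)); last first.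
  by rewrite lerD// ler_wpM2l// tent_le_sup.
rewrite /tent !(mulrCA _ (a n ^+ 2)) -mulrDr ler_wpM2l ?sqr_ge0//.
have [mx nx] : 0 <= Num.max 0 (T n - x) /\ T n - x <= Num.max 0 (T n - x).
  by rewrite !le_max !lexx orbT.
have [my ny] : 0 <= Num.max 0 (T n - y) /\ T n - y <= Num.max 0 (T n - y).
  by rewrite !le_max !lexx orbT.
rewrite ge_max addr_ge0 ?mulr_ge0//=.
apply: (@le_trans _ _ (p%:num * (T n - x) + (1 - p%:num) * (T n - y))).
  by rewrite le_eqVlt; apply/orP; left; apply/eqP; rewrite /z; ring.
by rewrite lerD// ler_wpM2l.
Qed.

(** A tent with foot at most [t] vanishes at both points; any other drops by at most
    [a n ^+ 2 * (s - t)]. The supremum inherits the common bound. *)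
Lemma tent_sup_slope K s t : 0 <= K -> (forall n, t < T n -> a n ^+ 2 <= K) ->
  0 < t -> t < s -> tent_sup t - tent_sup s <= K * (s - t).
Proof.
move=> K0 aK t0 ts; rewrite lerBlDr; apply: tent_sup_le => n.
have s0 := lt_trans t0 ts.
apply: (@le_trans _ _ (K * (s - t) + tent n s)); last first.
  by rewrite lerD2l tent_le_sup.
rewrite -lerBlDr -mulrBr; have [tT|Tt] := ltP t (T n); last first.
  have -> : Num.max 0 (T n - t) = 0 by apply/max_idPl; rewrite subr_le0.
  have -> : Num.max 0 (T n - s) = 0.
    by apply/max_idPl; rewrite subr_le0 (le_trans Tt)// ltW.
  by rewrite subrr mulr0 mulr_ge0// subr_ge0 ltW.
have -> : Num.max 0 (T n - t) = T n - t by apply/max_idPr; rewrite subr_ge0 ltW.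
have ? : T n - s <= Num.max 0 (T n - s) by rewrite le_max lexx orbT.
apply: (@le_trans _ _ (a n ^+ 2 * (s - t))).
  by rewrite ler_wpM2l ?sqr_ge0//; lra.
by rewrite ler_wpM2r ?aK// subr_ge0 ltW.
Qed.

Lemma sqrt_opp_derive1_tent_sup_le (t : R) : 0 < t ->
  ((Num.sqrt (- derive1 tent_sup t))%:E <=
   \sum_(n <oo) (a n * \1_(`]0%R, T n[%classic : set R) t)%:E)%E.
Proof.
move=> t0; set S := (X in (_ <= X)%E).
have term_ge0 n : (0 <= (a n * \1_(`]0%R, T n[%classic : set R) t)%:E)%E.
  by rewrite lee_fin mulr_ge0// ltW.
have aS n : t < T n -> ((a n)%:E <= S)%E.
  move=> tT; apply: le_trans (nneseries_lim_ge n.+1 (fun k _ _ => term_ge0 k)).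
  rewrite big_nat_recr//= -[leLHS]add0e leeD//; first exact: sume_ge0.
  by rewrite indicE mem_set ?mulr1//= in_itv/= t0.
have : (0 <= S)%E by apply: nneseries_ge0.
(* When finite, [S] dominates each [a n] with [t < T n], so [K = S ^+ 2] bounds all the slopes
   active at [t]. *)
case: S aS => [S|_ _|//]; last by rewrite leey.
move=> aS; rewrite !lee_fin => S0.
rewrite -[leRHS]ger0_norm// -sqrtr_sqr ler_wsqrtr//.
apply: opp_derive1_le; first exact: sqr_ge0.
move=> s ts; apply: tent_sup_slope => // [|n tT]; first exact: sqr_ge0.
by rewrite lerXn2r ?nnegrE ?(ltW (a_gt0 n))//; have := aS n tT; rewrite lee_fin.
Qed.

(** Sum and integral are exchanged by nonnegativity; the [n]-th integral is at most [a n * T n], and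
    the geometric series converges. *)
Lemma integral_tent_slopes_lty :
  (\int[lebesgue_measure]_(t in `]0%R, +oo[)
    (\sum_(n <oo) (a n * \1_(`]0%R, T n[%classic : set R) t)%:E) < +oo)%E.
Proof.
rewrite integral_nneseries//; last 2 first.
- by move=> n; apply/measurable_EFinP; exact: measurable_funM.
- by move=> n t _; rewrite lee_fin mulr_ge0// ltW.
apply: (@le_lt_trans _ _ (\sum_(n <oo) (2^-1 ^+ n : R)%:E)%E).
  apply: lee_nneseries => [n _ _|n _].
    by apply: integral_ge0 => t _; rewrite lee_fin mulr_ge0// ltW.
  under eq_integral do rewrite EFinM.
  rewrite ge0_integralZl_EFin//; last 2 first.
  - by apply/measurable_EFinP; exact: measurable_indic.
  - exact: ltW.
  rewrite integral_indic//.
  apply: (@le_trans _ _ ((a n)%:E * lebesgue_measure (`]0%R, T n[%classic : set R))%E).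
    apply: lee_wpmul2l; first by rewrite lee_fin ltW.
    by apply: le_measure; rewrite ?inE//; exact: measurableI.
  by rewrite lebesgue_measure_itv/= lte_fin T_gt0 sube0 lee_fin.
have -> : (fun N => \sum_(0 <= n < N) (2^-1 ^+ n : R)%:E)%E =
    eseries (fun n => (2 / (2 ^ (n + 1))%:R : R)%:E).
  apply/funext => N; apply: eq_bigr => n _; congr EFin.
  by rewrite addn1 natrX exprS invfM mulrA divff// mul1r exprVn.
by rewrite (cvg_lim _ (@cvg_geometric_eseries_half R 2 0))// ltry.
Qed.

End TentEnvelope.

Theorem mainTheorem5 (R : realType) (phi : R -> R)
    (phi_gt0 : forall t : R, 0 < t -> 0 < phi t)
    (phi_mono : {in `]0, +oo[ &, {homo phi : s t / s <= t}})
    (phi_oo : phi t @[t --> +oo] --> +oo) :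
  exists g : R -> R,
    [/\ forall t : R, 0 < t -> 0 < g t,
        convex_function (`]0, +oo[%classic : set R) g,
        g t @[t --> +oo] --> 0,
        (\int[lebesgue_measure]_(t in `]0%R, +oo[) (Num.sqrt (- derive1 g t))%:E
           < +oo)%E &
        limf_esup (fun t : R => (t * phi t * g t)%:E) +oo = +oo%E].
Proof.
(* [x n] will be the midpoint [T n / 2]. The tent there equals [1 / (4 * 4^n * x n)], hence the
   threshold on [phi]; [n < x n] sends the feet to infinity. *)
have /choice[x xP] : forall n, exists x : R,
    n%:R < x /\ 4 * 2 ^+ n ^+ 2 * n%:R <= phi x.
  move=> n; have [M [_ MP]] := (cvgryPge phi).1 phi_oo (4 * 2 ^+ n ^+ 2 * n%:R).
  exists (Num.max M n%:R + 1); split.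
    by rewrite ltr_pwDr// le_max lexx orbT.
  by apply: MP; rewrite ltr_pwDr// le_max lexx.
have x0 n : 0 < x n by apply: le_lt_trans (xP n).1.
pose T n := 2 * x n.
pose a n := 2^-1 ^+ n / T n.
have T0 n : 0 < T n by rewrite mulr_gt0.
have a0 n : 0 < a n by rewrite divr_gt0// exprn_gt0.
have aTE n : a n * T n = 2^-1 ^+ n by rewrite divfK// gt_eqF.
have aT n : a n * T n <= 2^-1 ^+ n by rewrite aTE.
have Toy t : exists n, t < T n.
  exists (Num.truncn t).+1; have [+ _] := xP (Num.truncn t).+1.
  have ? := truncnS_gt t; have ? := x0 (Num.truncn t).+1.
  rewrite /T; lra.
exists (tent_sup a T); split.
- by move=> t t0; exact: tent_sup_gt0.
- exact: convex_tent_sup.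
- exact: tent_sup_cvg0.
- apply: le_lt_trans (integral_tent_slopes_lty a0 T0 aT).
  apply: ge0_le_integral_nomeas => t /=; first by rewrite lee_fin sqrtr_ge0.
  by rewrite in_itv/= andbT => t0; exact: sqrt_opp_derive1_tent_sup_le.
(* The limsup is an infimum, over neighbourhoods [V] of [+oo], of suprema over [V]; each of these is
   shown to exceed every real [A]. *)
- apply/eqP; rewrite -leye_eq; apply: le_ereal_inf_tmp => _ [V [M [_ MV]] <-].
  rewrite leye_eq; apply/eqP/eqyP => A A0.
  (* This index exceeds both [M] and [A]: then [x n] lies in [V], and the value there is at least
     [n], hence at least [A]. *)
  pose n := (maxn (Num.truncn M) (Num.truncn A)).+1.
  have Mx : M < x n.
    apply: lt_trans (xP n).1; apply: lt_le_trans (truncnS_gt M) _.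
    by rewrite ler_nat ltnS leq_maxl.
  apply: (@le_trans _ _ (x n * phi (x n) * tent_sup a T (x n))%:E); last first.
    by apply: ereal_sup_ubound; exists (x n) => //; exact: MV.
  have An : A <= n%:R.
    by rewrite (le_trans (ltW (truncnS_gt A)))// ler_nat ltnS leq_maxr.
  rewrite lee_fin (le_trans An)//.
  have tentE : tent a T n (x n) = (4 * 2 ^+ n ^+ 2 * x n)^-1.
    rewrite /tent /a /T; have -> : 2 * x n - x n = x n by ring.
    rewrite (max_idPr _) ?ltW// exprVn; field.
    by rewrite !gt_eqF ?exprn_gt0.
  apply: (@le_trans _ _ (x n * phi (x n) * tent a T n (x n))); last first.
    by rewrite ler_wpM2l ?tent_le_sup// mulr_ge0 ?ltW// phi_gt0.
  have d0 : 0 < 4 * (2 : R) ^+ n ^+ 2 * x n by rewrite !mulr_gt0 ?exprn_gt0.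
  rewrite tentE ler_pdivlMr//.
  rewrite [leLHS](_ : _ = x n * (4 * 2 ^+ n ^+ 2 * n%:R)); last by ring.
  by rewrite ler_wpM2l ?(xP n).2// ltW.
Qed.
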